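(* For any natural numbers $d \ge 1$ and $n>1$ there exists a natural number $t$ (depending only on $d$ and $n$) with the following property: for every finite geometric simplicial complex $\mathcal{T}$ in $\mathbb{R}^d$ all of whose vertices lie in the integer lattice $\mathbb{Z}^d$, the number of points of $\mathbb{Z}^d$ lying in $t\,|\mathcal{T}|$ is congruent to $\chi(\mathcal{T})$ modulo $n$.
   Context: A finite geometric simplicial complex $\mathcal{T}$ in $\mathbb{R}^d$ is a finite collection of (closed, geometric) simplices in $\mathbb{R}^d$ that is closed under taking faces and such that any two of its simplices intersect in a common face (possibly empty). Its underlying space $|\mathcal{T}|$ is the union of its simplices. $\chi(\mathcal{T})$ denotes the Euler characteristic of $\mathcal{T}$, i.e. $\sum_{k\ge 0}(-1)^k f_k$, where $f_k$ is the number of $k$-dimensional simplices of $\mathcal{T}$. For a set $X\subseteq\mathbb{R}^d$ and $t>0$, $tX=\{tx : x\in X\}$ is the image of $X$ under the homothety with center at the origin and ratio $t$. *)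

(* Defs.v *)
From HB Require Import structures.
From mathcomp Require Import all_boot all_order all_algebra.
Set Implicit Arguments. Unset Strict Implicit. Unset Printing Implicit Defensive.
Import Order.TTheory GRing.Theory Num.Theory.
Local Open Scope ring_scope.

(* A finite geometric simplicial complex in R^d with integer vertices is
   encoded by a finite list of candidate vertices  v : 'I_m -> 'rV[int]_d
   (points of Z^d) and a family  K : {set {set 'I_m}}  of vertex sets; the
   simplex with vertex set s is the convex hull of {v i | i in s}.
   Coordinates are taken in an arbitrary real field R (e.g. the reals). *)

Section Complex.
Variables (R : realFieldType) (d m : nat) (v : 'I_m -> 'rV[int]_d).

Definition vR (i : 'I_m) : 'rV[R]_d := map_mx (fun z : int => z%:~R) (v i).

Definition in_hull (s : {set 'I_m}) (x : 'rV[R]_d) : Prop :=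
  exists lam : 'I_m -> R,
    [/\ forall i, 0 <= lam i,
        forall i, i \notin s -> lam i = 0,
        \sum_i lam i = 1
      & x = \sum_i lam i *: vR i].

Definition aff_indep (s : {set 'I_m}) : Prop :=
  forall mu : 'I_m -> R,
    (forall i, i \notin s -> mu i = 0) ->
    \sum_i mu i = 0 ->
    \sum_i mu i *: vR i = 0 ->
    forall i, mu i = 0.

Definition geom_complex (K : {set {set 'I_m}}) : Prop :=
  [/\ forall s, s \in K -> aff_indep s,
      forall s t : {set 'I_m}, s \in K -> t \subset s -> t \in K
    & forall s t : {set 'I_m}, s \in K -> t \in K ->
        forall x, in_hull s x -> in_hull t x -> in_hull (s :&: t) x].

Definition in_space (K : {set {set 'I_m}}) (x : 'rV[R]_d) : Prop :=
  exists2 s, s \in K & in_hull s x.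

Definition in_dilate (t : nat) (K : {set {set 'I_m}}) (x : 'rV[R]_d) : Prop :=
  exists2 y, in_space K y & x = t%:R *: y.

End Complex.

Definition euler_char (m : nat) (K : {set {set 'I_m}}) : int :=
  \sum_(s in K | s != set0) (-1) ^+ (#|s|.-1).

(* Main.v *)
Require Import Defs.
From HB Require Import structures.
From mathcomp Require Import all_boot all_order all_algebra.
From mathcomp Require Import ring lra zify.
From Stdlib Require Import Classical_Prop.
Import Order.TTheory GRing.Theory Num.Theory.
Local Open Scope ring_scope.
Set Implicit Arguments. Unset Strict Implicit. Unset Printing Implicit Defensive.

(** Split [t |K|] into the relatively open dilated faces.  A point of the open
    dilated [k]-simplex has positive barycentric coordinates [a i] of sum [t];
    writing [a i = c i + f i] with [c i] natural and [f i] in (0,1] puts it in a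
    unique translate of the half-open box spanned by the vertices.  A lattice
    point of the box at height [h = \sum_i f i] has [C(t - h + k, k)] such
    translates.  For [t = n * d!] this is 0 mod [n] when [1 <= h <= k], and
    [C(t - 1, k)], which is [(-1)^k] mod [n], for the unique box point of
    height [k + 1].  So every open face contributes [(-1)^k] mod [n]. *)

(** * Counting by duplicate-free lists *)

Definition enumerates {T : eqType} (P : T -> Prop) (s : seq T) : Prop :=
  uniq s /\ forall x, x \in s <-> P x.

(** [P] need not be decidable, so each candidate of [r] is kept or dropped by excluded middle. *)
Lemma enumerates_bounded (T : eqType) (P : T -> Prop) (r : seq T) :
  (forall x, P x -> x \in r) -> exists s, enumerates P s.
Proof.
move=> Pr.
suff [s [us sE]] : exists s, enumerates (fun x => x \in r /\ P x) s.
  by exists s; split=> // x; split=> [/sE[]//|Px]; apply/sE; split=> //; apply: Pr.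
elim: r {Pr} => [|y r [s [us sE]]]; first by exists [::]; split=> // x; split=> [|[]].
have [Py|nPy] := classic (P y); last first.
  exists s; split=> // x; split=> [/sE[xr Px]|[]].
    by rewrite inE xr orbT.
  by rewrite inE => /orP[/eqP->//|xr] Px; apply/sE.
exists (undup (y :: s)); split=> [|x]; first exact: undup_uniq.
rewrite mem_undup !inE; split=> [/orP[/eqP->|/sE[-> Px]]|[/orP[->//|xr] Px]].
- by rewrite eqxx.
- by rewrite orbT.
- by apply/orP; right; apply/sE.
Qed.

(** Disjoint pieces have additive counts, so congruences add up. This serves twice: for the box
    translates that fill an open simplex, and for the open faces that fill a complex. *)
Lemma enumerates_bigcup (I T : eqType) (n : int) (S : seq I)
    (P : I -> T -> Prop) (g : I -> int) :
  uniq S ->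
  (forall i, i \in S ->
     exists s, enumerates (P i) s /\ (n %| (size s)%:Z - g i)%Z) ->
  (forall i j x, i \in S -> j \in S -> P i x -> P j x -> i = j) ->
  exists s, enumerates (fun x => exists2 i, i \in S & P i x) s /\
    (n %| (size s)%:Z - \sum_(i <- S) g i)%Z.
Proof.
elim: S => [|i S IH] /=.
  move=> _ _ _; exists [::]; split; last by rewrite big_nil subrr dvdz0.
  by split=> // x; split=> // -[].
case/andP=> iS uS hS hD.
have [||s [[us sE] sn]] := IH uS.
- by move=> j jS; apply: hS; rewrite inE jS orbT.
- by move=> j k x jS kS; apply: hD; rewrite inE ?jS ?kS orbT.
have [|r [[ur rE] rn]] := hS i; first exact: mem_head.
exists (r ++ s); split; last first.
  rewrite big_cons size_cat PoszD.
  have -> : (size r)%:Z + (size s)%:Z - (g i + \sum_(j <- S) g j) =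
     ((size r)%:Z - g i) + ((size s)%:Z - \sum_(j <- S) g j) by ring.
  exact: rpredD.
split=> [|x].
  rewrite cat_uniq ur us andbT; apply/hasPn => x /sE[j jS Pj].
  apply/negP => /rE Pi; case/negP: iS.
  by rewrite (hD i j x) ?inE ?eqxx ?jS ?orbT.
rewrite mem_cat; split=> [/orP[/rE Px|/sE[j jS Px]]|[j]].
- by exists i; rewrite ?mem_head.
- by exists j; rewrite ?inE ?jS ?orbT.
- rewrite inE => /orP[/eqP->|jS] Px; apply/orP; [left; exact/rE|right].
  by apply/sE; exists j.
Qed.

(** Stars and bars, transported from the library count of tuples over ['I_N.+1]. *)
Lemma enumerates_compositions (k N : nat) :
  exists s : seq {ffun 'I_k.+1 -> nat},
    enumerates (fun c : {ffun 'I_k.+1 -> nat} => (\sum_i c i)%N = N) s /\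
    size s = 'C(N + k, k).
Proof.
pose A := [set c : k.+1.-tuple 'I_N.+1 | \sum_(i <- c) i == N]%N.
pose F (c : k.+1.-tuple 'I_N.+1) := [ffun i => val (tnth c i)].
have sumF c : (\sum_i F c i = \sum_(i <- c) i)%N.
  by rewrite big_tuple; apply: eq_bigr => i _; rewrite ffunE.
exists (map F (enum A)); split; last first.
  by rewrite size_map -cardE card_ord_partitions addnC.
split=> [|c].
  rewrite map_inj_uniq ?enum_uniq // => c c' /ffunP cc'.
  by apply: eq_from_tnth => i; apply: val_inj; have := cc' i; rewrite !ffunE.
split=> [/mapP[c']|cN].
  by rewrite mem_enum inE => /eqP cN ->; rewrite sumF.
(* No entry exceeds the total [N], so [inord] loses nothing. *)
have cE : c = F [tuple inord (c i) | i < k.+1].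
  apply/ffunP => i; rewrite ffunE tnth_mktuple /= inordK // ltnS -cN.
  by rewrite (bigD1 i) //= leq_addr.
apply/mapP; exists [tuple inord (c i) | i < k.+1] => //.
by rewrite mem_enum inE -sumF -cE cN.
Qed.

(** * Binomial coefficients modulo [n] *)

Section BinomialsModulo.
Variables n d : nat.

(** In [i * C(N, i) = N * C(N - 1, i - 1)] with [N = n * d!], the factor [i] divides [d!] and
    cancels, leaving a multiple of [n]. *)
Lemma dvdn_bin_fact i : (0 < i <= d)%N -> (n %| 'C(n * d`!, i))%N.
Proof.
case: i => // i /andP[_ id].
have /dvdnP[e eE] : (i.+1 %| d`!)%N by rewrite dvdn_fact.
apply/dvdnP; exists (e * 'C((n * d`!).-1, i))%N; apply/eqP.
by rewrite -(eqn_pmul2l (ltn0Sn i)) -mul_bin_diag eE; apply/eqP; ring.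
Qed.

(** Induction on [j] by Pascal's rule: both summands still have upper excess below the lower
    index. *)
Lemma dvdn_bin_fact_add j i : (j < i <= d)%N -> (n %| 'C(n * d`! + j, i))%N.
Proof.
elim: j i => [|j IH] [|i] //; first by rewrite addn0; exact: dvdn_bin_fact.
rewrite addnS binS => /andP[ji id].
by rewrite dvdn_add ?IH //; lia.
Qed.

(** By Pascal's rule, consecutive values [C(N - 1, k)] and [C(N - 1, k + 1)] sum to [C(N, k + 1)],
    which is 0 mod [n]; so the signs alternate from [C(N - 1, 0) = 1]. *)
Lemma dvdz_bin_fact_pred k : (0 < n)%N -> (k <= d)%N ->
  (n %| 'C((n * d`!).-1, k)%:Z - (-1) ^+ k)%Z.
Proof.
move=> n0; elim: k => [|k IH] kd; first by rewrite bin0 subrr dvdz0.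
have := @dvdn_bin_fact k.+1 kd.
have <- : (n * d`!).-1.+1 = (n * d`!)%N by rewrite prednK // muln_gt0 n0 fact_gt0.
rewrite binS /= => H.
have -> : 'C((n * d`!).-1, k.+1)%:Z - (-1) ^+ k.+1 =
   ('C((n * d`!).-1, k.+1) + 'C((n * d`!).-1, k))%N%:Z -
   ('C((n * d`!).-1, k)%:Z - (-1) ^+ k) :> int.
  by rewrite PoszD exprS; ring.
by apply: rpredB; [exact: H|apply: IH; exact: ltnW].
Qed.

End BinomialsModulo.

Lemma inord_shift (a : int) (b : nat) : `|a| <= b%:Z ->
  a = (inord (absz (a + b%:Z)) : 'I_(2 * b).+1)%:Z - b%:Z.
Proof. by move=> ab; rewrite inordK; lia. Qed.

(** * Rounding and the embedding of the lattice *)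

Section RealField.
Variable R : realFieldType.

(** Here [c] is the ceiling of [a] minus one. A real field may be non-archimedean, so the bound [t]
    is what makes the induction possible. *)
Lemma ceil_exists (a : R) (t : nat) : 0 < a -> a <= t%:R ->
  exists c : nat, 0 < a - c%:R <= 1.
Proof.
move=> a0; elim: t => [|t IH] at_; first by lra.
have [/IH//|ta] := lerP a t%:R.
by exists t; rewrite -natr1 in at_; apply/andP; split; lra.
Qed.

Lemma ceil_unique (f f' : R) (c c' : nat) :
  0 < f <= 1 -> 0 < f' <= 1 -> f + c%:R = f' + c'%:R -> c = c'.
Proof.
move=> /andP[f0 f1] /andP[f0' f1'] e.
have cc' : (c < c'.+1)%N by rewrite -(ltr_nat R) -natr1; lra.
have c'c : (c' < c.+1)%N by rewrite -(ltr_nat R) -natr1; lra.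
by apply/eqP; rewrite eqn_leq -ltnS cc' -ltnS c'c.
Qed.

Lemma sum_scalerDl (V : lmodType R) k (a b : 'I_k -> R) (u : 'I_k -> V) :
  \sum_i (a i + b i) *: u i = \sum_i a i *: u i + \sum_i b i *: u i.
Proof. by under eq_bigr do rewrite scalerDl; rewrite big_split. Qed.

Section Embedding.
Variable d : nat.

Definition toR (z : 'rV[int]_d) : 'rV[R]_d := map_mx (fun a : int => a%:~R) z.

Lemma toR_inj : injective toR.
Proof.
move=> x y /matrixP xy; apply/matrixP => i j.
by have := xy i j; rewrite !mxE => /intr_inj.
Qed.

Lemma toR_comb k (w : 'I_k -> 'rV[int]_d) (c : 'I_k -> nat) (q : 'rV[int]_d) :
  toR (q + \sum_i w i *+ c i) = toR q + \sum_i (c i)%:R *: vR R w i.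
Proof.
apply/matrixP => i j; rewrite !mxE rmorphD /= !summxE rmorph_sum /=.
by congr (_ + _); apply: eq_bigr => l _; rewrite !mxE mulmxnE rmorphMn /= mulr_natl.
Qed.

End Embedding.

(** * Lattice points of one open dilated simplex *)

Section Simplex.
Variables (d k : nat) (w : 'I_k.+1 -> 'rV[int]_d).
Hypothesis free_w : aff_indep R w [set: 'I_k.+1].

Lemma aff_indepT (mu : 'I_k.+1 -> R) (i : 'I_k.+1) :
  \sum_j mu j = 0 -> \sum_j mu j *: vR R w j = 0 -> mu i = 0.
Proof. by move=> mu0 muw; apply: free_w mu0 muw i => j; rewrite inE. Qed.

Lemma aff_coord_unique (a b : 'I_k.+1 -> R) :
  \sum_i a i = \sum_i b i ->
  \sum_i a i *: vR R w i = \sum_i b i *: vR R w i -> a =1 b.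
Proof.
move=> ab abw i; apply/eqP; rewrite -subr_eq0; apply/eqP.
apply: (@aff_indepT (fun i => a i - b i)).
- by rewrite sumrB ab subrr.
- by under eq_bigr do rewrite scalerBl; rewrite sumrB abw subrr.
Qed.

(** Affine independence makes the rows [(1, w i)] linearly independent in dimension [1 + d]. The
    bound puts [k] in the range of the divisibility lemmas. *)
Lemma aff_indep_dim : (k <= d)%N.
Proof.
pose A : 'M[R]_(k.+1, 1 + d) :=
  row_mx (const_mx 1) (\matrix_(i, j) vR R w i 0 j).
suff /eqP rA : row_free A by rewrite -ltnS -rA -[in X in (_ <= X)%N]add1n rank_leq_col.
apply: inj_row_free => u; rewrite mul_mx_row -row_mx0 => /eq_row_mx[u1 u2].
apply/rowP => i; rewrite mxE.
apply: (@aff_indepT (fun i => u 0 i)).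
- move/matrixP/(_ 0 0): u1; rewrite !mxE => u10; rewrite -[RHS]u10.
  by apply: eq_bigr => j _; rewrite mxE mulr1.
- apply/rowP => j; move/matrixP/(_ 0 j): u2; rewrite !mxE summxE => u2j; rewrite -[RHS]u2j.
  by apply: eq_bigr => l _; rewrite !mxE.
Qed.

(** The lattice points of the fundamental parallelepiped spanned by the vectors [(1, w i)] in the
    cone over the simplex, with the height as a separate component. *)
Definition in_box (hq : nat * 'rV[int]_d) : Prop :=
  exists f : 'I_k.+1 -> R,
    [/\ forall i, 0 < f i <= 1, \sum_i f i = hq.1%:R
      & \sum_i f i *: vR R w i = toR hq.2].

Lemma in_box_height hq : in_box hq -> (0 < hq.1 <= k.+1)%N.
Proof.
case=> f [f01 fs _]; rewrite -(ltr_nat R) -(ler_nat R) -fs; apply/andP; split.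
  rewrite (bigD1 ord0) //= ltr_pwDl //; first by case/andP: (f01 ord0).
  by apply: sumr_ge0 => i _; case/andP: (f01 i) => /ltW.
rewrite -[leRHS](_ : \sum_(i < k.+1) 1 = _); last by rewrite sumr_const card_ord.
by apply: ler_sum => i _; case/andP: (f01 i).
Qed.

(** If [k + 1] coordinates, each at most 1, have sum [k + 1], then all equal 1. *)
Lemma in_box_top (q : 'rV[int]_d) : in_box (k.+1, q) <-> q = \sum_i w i.
Proof.
have E : toR (\sum_i w i) = \sum_i 1 *: vR R w i.
  have := @toR_comb d k.+1 w (fun=> 1%N) 0.
  rewrite add0r => ->; rewrite [toR 0](_ : _ = 0) ?add0r //.
  by apply/matrixP => i j; rewrite !mxE.
split=> [[f [f01 /= fs fq]]|->]; last first.
  by exists (fun=> 1); split=> [i||//=]; rewrite ?ltr01 ?lexx // sumr_const card_ord.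
apply: toR_inj; rewrite E -fq; apply: eq_bigr => i _; congr (_ *: _).
have g0 : \sum_i (1 - f i) == 0 by rewrite sumrB fs sumr_const card_ord subrr.
move: g0; rewrite psumr_eq0 => [|j _]; last by case/andP: (f01 j); rewrite subr_ge0.
by move/allP/(_ i (mem_index_enum _)); rewrite subr_eq0 => /eqP.
Qed.

(** Heights are at most [k + 1], and since every [f i] is at most 1 each coordinate is bounded by
    the sum of all absolute vertex coordinates. *)
Lemma enumerates_box : exists s, enumerates in_box s.
Proof.
pose B := (\sum_i \sum_j `|w i ord0 j|)%N.
(* Shifting by [B] encodes the interval from [-B] to [B] as a finite ordinal type. *)
pose G (u : 'rV['I_(2 * B).+1]_d) : 'rV[int]_d :=
  map_mx (fun x : 'I_(2 * B).+1 => (x : nat)%:Z - B%:Z) u.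
apply: (@enumerates_bounded _ _
  [seq (h, G u) | h <- iota 0 k.+2, u <- enum [set: 'rV['I_(2 * B).+1]_d]]).
case=> h q bq; have /andP[_ hk] := in_box_height bq.
apply/allpairsP; exists (h, map_mx (fun z : int => inord (absz (z + B%:Z))) q).
split; [by rewrite mem_iota|by rewrite mem_enum inE|congr (_, _)].
case: bq => f [f01 _ /= fq]; apply/rowP => j; rewrite !mxE.
have qB : `|q 0 j| <= B%:Z.
  rewrite -(ler_int R) intr_norm.
  move/rowP/(_ j): fq; rewrite summxE [toR q 0 j]mxE => <-.
  apply: (le_trans (ler_norm_sum _ _ _)).
  rewrite -pmulrn /B natr_sum; apply: ler_sum => i _.
  rewrite !mxE normrM (bigD1 j) //= natrD.
  apply: (@le_trans _ _ `|(w i 0 j)%:~R|).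
    case/andP: (f01 i) => f0 f1; rewrite gtr0_norm //.
    by rewrite ler_piMl.
  by rewrite -intr_norm -abszE ler_wpDr.
exact: inord_shift qB.
Qed.

Definition box_translate (t : nat) (hq : nat * 'rV[int]_d) (z : 'rV[int]_d) :=
  exists c : {ffun 'I_k.+1 -> nat},
    (\sum_i c i + hq.1)%N = t /\ z = hq.2 + \sum_i w i *+ c i.

(** By affine independence, distinct [c] of the same sum give distinct points, so the compositions
    of [t - hq.1] are being counted. *)
Lemma enumerates_box_translate t hq : (hq.1 <= t)%N ->
  exists s, enumerates (box_translate t hq) s /\ size s = 'C(t - hq.1 + k, k).
Proof.
move=> ht; have [s [[us sE] ss]] := enumerates_compositions k (t - hq.1).
exists [seq hq.2 + \sum_i w i *+ c i | c : {ffun 'I_k.+1 -> nat} <- s].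
split; last by rewrite size_map.
split.
  rewrite map_inj_in_uniq // => c c' /sE cN /sE cN' /(congr1 (@toR d)).
  rewrite !toR_comb => /addrI e; apply/ffunP => i; apply/eqP.
  rewrite -(eqr_nat R).
  rewrite (@aff_coord_unique (fun i => (c i)%:R) (fun i => (c' i)%:R)) //.
  by rewrite -!natr_sum cN cN'.
move=> z; split=> [/mapP[c /sE cN ->]|[c [ct zE]]].
  by exists c; rewrite cN subnK.
by apply/mapP; exists c => //; apply/sE; rewrite -ct addnK.
Qed.

Definition in_open_dilate (t : nat) (z : 'rV[int]_d) : Prop :=
  exists a : 'I_k.+1 -> R,
    [/\ forall i, 0 < a i, \sum_i a i = t%:R
      & \sum_i a i *: vR R w i = toR z].

(** Barycentric coordinates are unique, and so is the splitting of each one into a natural number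
    and a part in (0,1]. *)
Lemma box_translate_disjoint t hq hq' z :
  in_box hq -> in_box hq' -> box_translate t hq z -> box_translate t hq' z ->
  hq = hq'.
Proof.
case: hq hq' => [h q] [h' q'] [f [f01 /= fs fq]] [f' [f01' /= fs' fq']].
move=> [c [/= ct zE]] [c' [/= ct' zE']].
have e : (fun i => f i + (c i)%:R) =1 (fun i => f' i + (c' i)%:R).
  apply: aff_coord_unique.
    by rewrite !big_split /= fs fs' -!natr_sum -!natrD ![(h + _)%N]addnC
               ![(h' + _)%N]addnC ct ct'.
  by rewrite !sum_scalerDl fq fq' -!toR_comb -zE -zE'.
have cc i : c i = c' i by apply: ceil_unique (f01 i) (f01' i) (e i).
have hh : h = h'.
  by apply/eqP; rewrite -(eqn_add2l (\sum_i c i)%N) ct (eq_bigr _ (fun i _ => cc i)) ct'.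
congr (_, _) => //; apply: (@addIr _ (\sum_i w i *+ c i)).
by rewrite -zE zE'; congr (_ + _); apply: eq_bigr => i _; rewrite cc.
Qed.

Lemma in_open_dilate_box t z :
  in_open_dilate t z <-> exists2 hq, in_box hq & box_translate t hq z.
Proof.
split=> [[a [a0 as_ az]]|[[h q] [f [f01 /= fs fq]] [c [/= ct ->]]]]; last first.
  exists (fun i => f i + (c i)%:R); split.
  - by move=> i; case/andP: (f01 i) => f0 _; rewrite ltr_pwDl.
  - by rewrite big_split /= fs -natr_sum -natrD addnC ct.
  - by rewrite sum_scalerDl fq toR_comb.
(* The other coordinates are nonnegative, so [a i <= t], the bound that [ceil_exists] asks for. *)
have /fin_all_exists[c cP] i : exists c : nat, 0 < a i - c%:R <= 1.
  apply: (@ceil_exists _ t) => //; rewrite -as_ (bigD1 i) //= lerDl.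
  by apply: sumr_ge0 => j _; apply: ltW.
(* This keeps the truncated subtraction in the height below exact. *)
have cs : (\sum_i c i <= t)%N.
  rewrite -(ler_nat R) natr_sum -as_; apply: ler_sum => i _.
  by case/andP: (cP i); rewrite subr_gt0 => /ltW.
exists ((t - \sum_i c i)%N, z - \sum_i w i *+ c i).
  exists (fun i => a i - (c i)%:R); split=> //=.
    by rewrite sumrB as_ natrB // natr_sum.
  under eq_bigr do rewrite scalerBl.
  rewrite sumrB az -[in toR z](subrK (\sum_i w i *+ c i) z) toR_comb.
  by rewrite addrK.
exists (finfun c); split=> /=.
  by under eq_bigr do rewrite ffunE; rewrite subnKC.
by under [X in _ + X]eq_bigr do rewrite ffunE; rewrite subrK.
Qed.

Lemma count_open_dilate n : (0 < d)%N -> (1 < n)%N ->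
  exists s, enumerates (in_open_dilate (n * d`!)) s /\
    (n %| (size s)%:Z - (-1) ^+ k)%Z.
Proof.
move=> d0 n1; set t := (n * d`!)%N; have kd := aff_indep_dim.
(* With [k <= d], every height [h <= k + 1] is at most [t], so [t - h] is never truncated. *)
have dt : (d < t)%N.
  have : (d <= d`!)%N by exact: fact_geq.
  by rewrite /t; nia.
have [S [uS SE]] := enumerates_box.
have [||s [[us sE] sn]] := @enumerates_bigcup _ _ n S (box_translate t)
  (fun hq => if hq == (k.+1, \sum_i w i) then (-1) ^+ k else 0) uS.
- move=> [h q] /SE hb; have /= /andP[h0 hk] := in_box_height hb.
  have [|s [sE ss]] := @enumerates_box_translate t (h, q); first by rewrite /=; lia.
  exists s; split=> //; rewrite ss /=.
  move: hk; rewrite leq_eqVlt => /orP[/eqP hE|hk].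
    move: hb; rewrite hE => /in_box_top ->; rewrite eqxx.
    rewrite (_ : (t - k.+1 + k)%N = t.-1); last by lia.
    by apply: dvdz_bin_fact_pred => //; lia.
  rewrite xpair_eqE (_ : (h == k.+1) = false) ?subr0; last by apply/eqP; lia.
  (* The excess [k - h] is below [k] because [h] is positive, as [dvdn_bin_fact_add] requires. *)
  rewrite (_ : (t - h + k)%N = (t + (k - h))%N); last by lia.
  by apply: dvdn_bin_fact_add; lia.
- by move=> i j x /SE ib /SE jb; exact: box_translate_disjoint.
exists s; split.
  split=> // z; split=> [/sE[hq /SE hb hz]|/in_open_dilate_box[hq hb hz]].
    by apply/in_open_dilate_box; exists hq.
  by apply/sE; exists hq => //; apply/SE.
move: sn; rewrite (bigD1_seq (k.+1, \sum_i w i)) //=; last by apply/SE/in_box_top.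
by rewrite eqxx big1 ?addr0 // => hq /negPf->.
Qed.

End Simplex.

(** * Decomposition of a complex into open faces *)

Section Complex.
Variables (d m : nat) (v : 'I_m -> 'rV[int]_d).

(** The first two clauses together force [a] to vanish off [s]. Weights on all [m] vertices allow
    points of different faces to be compared directly. *)
Definition in_open_face (t : nat) (s : {set 'I_m}) (z : 'rV[int]_d) : Prop :=
  exists a : 'I_m -> R,
    [/\ forall i, 0 <= a i, forall i, (0 < a i) = (i \in s), \sum_i a i = t%:R
      & \sum_i a i *: vR R v i = toR z].

Lemma sum_support (V : nmodType) (s : {set 'I_m}) (F : 'I_m -> V) :
  (forall i, i \notin s -> F i = 0) ->
  \sum_i F i = \sum_(j < #|s|) F (enum_val j).
Proof.
move=> F0; rewrite -big_enum_val [RHS]big_mkcond /=; apply: eq_bigr => i _.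
by case: ifPn => // /F0.
Qed.

(** Extension by zero: [enum_val] is injective, so the sum has at most one term. *)
Definition extend (s : {set 'I_m}) (b : 'I_#|s| -> R) (i : 'I_m) : R :=
  \sum_(j | enum_val j == i) b j.

Lemma extend_enum_val (s : {set 'I_m}) (b : 'I_#|s| -> R) (j : 'I_#|s|) : extend b (enum_val j) = b j.
Proof. by rewrite /extend (big_pred1 j) // => l; rewrite (inj_eq enum_val_inj). Qed.

Lemma extend_notin (s : {set 'I_m}) (b : 'I_#|s| -> R) i : i \notin s -> extend b i = 0.
Proof.
move=> is_; rewrite /extend big_pred0 // => j.
by apply: contraNF is_ => /eqP<-; exact: enum_valP.
Qed.

Lemma sum_extend (s : {set 'I_m}) (b : 'I_#|s| -> R) : \sum_i extend b i = \sum_j b j.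
Proof.
rewrite (sum_support (@extend_notin s b)).
by apply: eq_bigr => j _; rewrite extend_enum_val.
Qed.

Lemma sum_extend_scale (s : {set 'I_m}) (b : 'I_#|s| -> R) :
  \sum_i extend b i *: vR R v i = \sum_j b j *: vR R (fun j : 'I_#|s| => v (enum_val j)) j.
Proof.
rewrite (@sum_support _ s) => [|i /extend_notin->]; last by rewrite scale0r.
by apply: eq_bigr => j _; rewrite extend_enum_val.
Qed.

Lemma aff_indep_enum_val (s : {set 'I_m}) : aff_indep R v s ->
  aff_indep R (fun j : 'I_#|s| => v (enum_val j)) [set: 'I_#|s|].
Proof.
move=> vs mu _ mu0 muv j; rewrite -(@extend_enum_val s mu j).
by apply: vs; [exact: extend_notin|rewrite sum_extend|rewrite sum_extend_scale].
Qed.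

Lemma count_open_face n (s : {set 'I_m}) : (0 < d)%N -> (1 < n)%N ->
  aff_indep R v s -> s != set0 ->
  exists r, enumerates (in_open_face (n * d`!) s) r /\
    (n %| (size r)%:Z - (-1) ^+ #|s|.-1)%Z.
Proof.
move=> d0 n1 /aff_indep_enum_val vs; rewrite -card_gt0.
(* Restriction to [s] and extension by zero translate between weights on all vertices and weights on
   ['I_#|s|]. *)
have faceE z : in_open_face (n * d`!) s z <-> exists b : 'I_#|s| -> R,
    [/\ forall j, 0 < b j, \sum_j b j = (n * d`!)%:R
      & \sum_j b j *: vR R (fun j : 'I_#|s| => v (enum_val j)) j = toR z].
  split=> [[a [a0 aP as_ az]]|[b [b0 bs bz]]].
    have a_off i : i \notin s -> a i = 0.
      by rewrite -aP -leNgt => ai; apply/eqP; rewrite eq_le ai a0.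
    exists (fun j : 'I_#|s| => a (enum_val j)); split=> [j||].
    - by rewrite aP enum_valP.
    - by rewrite -as_ (sum_support a_off).
    - by rewrite -az (@sum_support _ s) // => i /a_off->; rewrite scale0r.
  have ext0 i : (0 < extend b i) = (i \in s).
    have [is_|/[dup] /extend_notin-> _] := boolP (i \in s); last by rewrite ltxx.
    by rewrite -(enum_rankK_in is_ is_) extend_enum_val b0.
  exists (extend b); split=> // [i||].
  - have [is_|/extend_notin->//] := boolP (i \in s).
    by rewrite ltW // ext0.
  - by rewrite sum_extend.
  - by rewrite sum_extend_scale.
(* Generalizing the cardinal lets it be written [k.+1]; the zero case contradicts nonemptiness. *)
move: #|s| (fun j => v _) vs faceE => [//|k] w vw faceE _.
have [r [[ur rE] rn]] := count_open_dilate vw d0 n1.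
by exists r; split=> //; split=> // z; split=> [/rE/faceE|/faceE/rE].
Qed.

Lemma in_open_face_hull (t : nat) (s : {set 'I_m}) z : (0 < t)%N ->
  in_open_face t s z -> in_hull v s (t%:R^-1 *: toR z).
Proof.
rewrite -(ltr0n R) => t0.
case=> a [a0 aP as_ az]; exists (fun i => t%:R^-1 * a i); split=> [i|i||].
- by rewrite mulr_ge0 // invr_ge0 ltW.
- by rewrite -aP lt0r a0 andbT negbK => /eqP->; rewrite mulr0.
- by rewrite -mulr_sumr as_ mulVf ?gt_eqF.
- by under eq_bigr do rewrite -scalerA; rewrite -scaler_sumr az.
Qed.

(** A point lies in the open face spanned by the support of its barycentric coordinates; that
    support belongs to [K] by closure under faces. *)
Lemma in_dilate_face (t : nat) (K : {set {set 'I_m}}) (z : 'rV[int]_d) :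
  (0 < t)%N -> (forall s r : {set 'I_m}, s \in K -> r \subset s -> r \in K) ->
  in_dilate v t K (toR z) <->
  exists2 s, s \in [set s in K | s != set0] & in_open_face t s z.
Proof.
move=> t0 Kdown; have tR0 : 0 < t%:R :> R by rewrite ltr0n.
split=> [[y [s sK [a [a0 as_ a1 ->]]] zE]|[s]].
  exists [set i | 0 < a i].
    rewrite inE (Kdown s) //=.
      (* An empty support would contradict that the coordinates sum to 1. *)
      apply/eqP => /setP sup0; case/eqP: (oner_neq0 R); rewrite -a1 big1 // => i _.
      by apply/eqP; rewrite eq_le a0 andbT leNgt; have := sup0 i; rewrite !inE => ->.
    by apply/subsetP => i; rewrite inE; apply: contraLR => /as_->; rewrite ltxx.
  exists (fun i => t%:R * a i); split=> [i|i||].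
  - by rewrite mulr_ge0 ?ler0n.
  - by rewrite inE pmulr_rgt0.
  - by rewrite -mulr_sumr a1 mulr1.
  - by under eq_bigr do rewrite -scalerA; rewrite -scaler_sumr zE.
rewrite inE => /andP[sK _] /(in_open_face_hull t0) sz.
exists (t%:R^-1 *: toR z); last by rewrite scalerA divff ?scale1r ?gt_eqF.
by exists s.
Qed.

(** The rescaled point lies in both hulls, hence in that of [s :&: r]. Uniqueness of coordinates in
    [s] then makes the positive weights on [s] vanish off [r]. *)
Lemma in_open_face_sub (t : nat) (K : {set {set 'I_m}}) (s r : {set 'I_m}) z :
  (0 < t)%N -> geom_complex R v K -> s \in K -> r \in K ->
  in_open_face t s z -> in_open_face t r z -> s \subset r.
Proof.
move=> t0 [Kfree _ Kcap] sK rK; have tR0 : 0 < t%:R :> R by rewrite ltr0n.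
move=> sz /(in_open_face_hull t0) rh.
have [b [b0 bsr b1 bz]] := Kcap _ _ sK rK _ (in_open_face_hull t0 sz) rh.
case: sz => a [a0 aP as_ az].
have ab : forall i, a i - t%:R * b i = 0.
  apply: (Kfree s sK).
  - move=> i is_; rewrite bsr ?mulr0 ?subr0; last by rewrite inE (negPf is_).
    by apply/eqP; move: is_; rewrite -aP lt0r a0 andbT negbK.
  - by rewrite sumrB as_ -mulr_sumr b1 mulr1 subrr.
  - under eq_bigr do rewrite scalerBl -scalerA.
    by rewrite sumrB az -scaler_sumr -bz scalerA divff ?scale1r ?subrr ?gt_eqF.
apply/subsetP => i is_; apply: contraLR is_ => ir.
have /eqP := ab i; rewrite bsr ?mulr0 ?subr0; last by rewrite inE (negPf ir) andbF.
by move=> /eqP ai; rewrite -aP ai ltxx.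
Qed.

End Complex.

End RealField.

Theorem theorem1 (d n : nat) (hd : (1 <= d)%N) (hn : (1 < n)%N) :
  exists t : nat, (0 < t)%N /\
    forall (R : realFieldType) (m : nat) (v : 'I_m -> 'rV[int]_d)
           (K : {set {set 'I_m}}),
      geom_complex R v K ->
      exists2 pts : seq 'rV[int]_d,
        uniq pts /\
        (forall z : 'rV[int]_d,
            z \in pts <->
            in_dilate v t K (map_mx (fun a : int => (a%:~R : R)) z)) &
        ((size pts)%:Z = euler_char K %[mod n%:Z])%Z.
Proof.
have t0 : (0 < n * d`!)%N by rewrite muln_gt0 fact_gt0 ltnW.
exists (n * d`!)%N; split=> // R m v K GK; have [Kfree Kdown _] := GK.
have [|||pts [[upts ptsE] sz]] := @enumerates_bigcup _ _ n%:Z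
  (enum [set s in K | s != set0]) (in_open_face R v (n * d`!))
  (fun s => (-1) ^+ #|s|.-1).
- exact: enum_uniq.
- move=> s; rewrite mem_enum inE => /andP[sK s0].
  exact: count_open_face (Kfree s sK) s0.
(* Open faces sharing a point coincide, by inclusion both ways. *)
- move=> s r z; rewrite !mem_enum !inE => /andP[sK _] /andP[rK _] sz rz.
  apply/eqP; rewrite eqEsubset.
  by rewrite (in_open_face_sub t0 GK sK rK sz rz) (in_open_face_sub t0 GK rK sK rz sz).
exists pts.
  split=> // z; have zE := @in_dilate_face R d m v _ K z t0 Kdown.
  split=> [/ptsE|/zE] [s sK sz']; last by apply/ptsE; exists s; rewrite ?mem_enum.
  by apply/zE; exists s => //; rewrite mem_enum in sK.
apply/eqP; rewrite eqz_mod_dvd; move: sz; rewrite big_enum /= /euler_char.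
by congr (_ %| _ - _)%Z; apply: eq_bigl => s; rewrite inE.
Qed.
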